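(* Let $p \geq 0$ be an integer, and let the $p$-Bernoulli numbers $B_{n,p}$ ($n \geq 0$) be defined by the exponential generating function \[ \sum_{n\geq 0} B_{n,p}\frac{t^n}{n!} = {}_2F_1\left(1,1;p+2;1-e^{t}\right). \] Then \[ \sum_{n=0}^{\infty} B_{n,p}\frac{t^n}{n!} = \frac{(p+1)(t-H_p)e^{pt}}{(e^{t}-1)^{p+1}} + (p+1)\sum_{k=1}^{p}\binom{p}{k}\frac{H_k}{(e^{t}-1)^{k+1}}, \] as an identity of functions of $t$ on a punctured neighbourhood of $t=0$. The singularities at $t=0$ on the right-hand side cancel, so the right-hand side extends analytically to $t=0$ and its Taylor expansion there is the left-hand side.
   Context: ${}_2F_1(a,b;c;z)=\sum_{m\geq 0}\frac{(a)_m (b)_m}{(c)_m}\frac{z^m}{m!}$ is the Gaussian hypergeometric function. Here $(x)_m = x(x+1)\cdots(x+m-1)$ is the rising factorial. The series converges and is analytic for $|z|<1$, so ${}_2F_1(1,1;p+2;1-e^t)$ is analytic for $t$ near $0$. The numbers $B_{n,p}$ are defined as $n!$ times its Taylor coefficients at $t=0$. $H_n$ denotes the harmonic numbers: $H_0=0$ and $H_n=\sum_{j=1}^{n}\frac{1}{j}$ for $n\geq 1$. *)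

(* Defs.v *)
From Stdlib Require Import Reals Factorial.
From Coquelicot Require Import Coquelicot.

Open Scope R_scope.
Open Scope C_scope.

Definition cexp (z : C) : C :=
  RtoC (exp (Re z)) * (RtoC (cos (Im z)) + Ci * RtoC (sin (Im z))).

(* [iota] returns the unique [l] such that [is_series u l]; the value is
   meaningful only when the series converges. *)
Definition CSeries (u : nat -> C) : C :=
  iota (T := C_CompleteNormedModule) (is_series (V := C_NormedModule) u).

Fixpoint rising (x : C) (m : nat) : C :=
  match m with
  | O => 1
  | S m' => rising x m' * (x + RtoC (INR m'))
  end.

Definition hyp2F1 (a b c z : C) : C :=
  CSeries (fun m => rising a m * rising b m / rising c m
                    * (z ^ m / RtoC (INR (fact m)))).

(* Coquelicot's [C_derive] is total, with its limit taken along the real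
   direction; it is the complex derivative wherever [ex_derive] over
   [C_AbsRing] holds ([C_derive_correct], [is_C_derive_unique]). *)
Definition C_derive_n (f : C -> C) (n : nat) : C -> C :=
  Nat.iter n C_derive f.

Definition pBernoulli_fun (p : nat) (t : C) : C :=
  hyp2F1 1 1 (RtoC (INR p) + 2) (1 - cexp t).

(* n! times the n-th Taylor coefficient at 0 is the n-th complex derivative
   at 0. *)
Definition pBernoulli (n p : nat) : C := C_derive_n (pBernoulli_fun p) n 0.

Definition harmonic (n : nat) : R := sum_n_m (fun j => (/ INR j)%R) 1 n.

(* Main.v *)
Require Import Defs.
From Stdlib Require Import Reals Factorial Lra Lia List.
From Coquelicot Require Import Coquelicot.

(* Write [h_p(z) = 2F1(1,1;p+2;z)] and [w = e^t - 1]. Comparing coefficients gives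
   the contiguous relation [(q+1) z h_(q+1) = (q+2) ((z - 1) h_q + 1)], which at
   [z = -w] reads [(q+1) w h_(q+1) = (q+2) (e^t h_q - 1)], while
   [z h_0(z) = - log (1 - z)] gives [w h_0 = t]. By Pascal's rule, applied to
   [sum_k C(p,k) H_k w^-k], the closed form obeys the same recursion.
   The recursion also shows that [h_p(1 - e^t)] is a power series in [t]: the
   numerator [e^t h_q - 1] vanishes at [0], and [t / (e^t - 1)] is a power series
   since the reciprocal of [(e^t - 1) / t] has coefficients bounded by [1]. *)

Open Scope R_scope.
Open Scope C_scope.

(** Substituting the series of [1 - cexp t] into the hypergeometric series and regrouping by powers
    of [t] would mean rearranging a double series. The recursion in [p] avoids this: it needs only
    products of power series and the division by [t] of a power series without constant term. The
    price is paid at [t = 0], where the recursion reads 0 = 0 and says nothing about the next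
    function; its value there is checked separately, through the derivative of the previous one.
    Power series are needed because [pBernoulli] is defined by iterated derivatives at 0, whereas
    the closed form is reached only for [t <> 0]. The two arguments are independent inductions on
    [p] over one disc, chosen so that [1 - cexp t] stays in the unit disc. No complex logarithm
    enters: w h_0 = t follows from a vanishing derivative. *)

Ltac as_real_eq := match goal with |- @eq _ ?x ?y => change (@eq R x y) end.
(** These casts serve [ring] and [field]: equalities arise at the carrier of an algebraic structure
    and have to be retyped at [R] or [C] itself. *)
Ltac as_complex_eq := match goal with |- @eq _ ?x ?y => change (@eq C x y) end.

(** * Complex series and derivatives *)

Definition Cis_series (u : nat -> C) (l : C) : Prop :=
  is_series (V := C_NormedModule) u l.

Definition Cis_derive (f : C -> C) (z l : C) : Prop :=
  is_derive (K := C_AbsRing) (V := C_NormedModule) f z l.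

Lemma sum_n_C (u : nat -> C) (n : nat) :
  sum_n (G := C_AbelianMonoid) u n
  = (sum_n (fun k => Re (u k)) n, sum_n (fun k => Im (u k)) n).
Proof.
  induction n as [|n IH].
  - rewrite !sum_O. now destruct (u 0%nat).
  - rewrite !sum_Sn, IH. now destruct (u (S n)).
Qed.

(** Balls of [C] are products of real balls. This carries facts on real series over to [C], the
    Cauchy product above all. *)
Lemma Cis_series_components (u : nat -> C) (l : C) :
  Cis_series u l <->
  is_series (fun n => Re (u n)) (Re l) /\ is_series (fun n => Im (u n)) (Im l).
Proof.
  split.
  - intros H; split; intros P [e He].
    + destruct (H (fun z : C => P (Re z))) as [N HN].
      { exists e. intros z [Hz _]. apply He, Hz. }
      exists N. intros n Hn.
      assert (K : P (Re (sum_n (G := C_AbelianMonoid) u n))) by exact (HN n Hn).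
      rewrite sum_n_C in K. exact K.
    + destruct (H (fun z : C => P (Im z))) as [N HN].
      { exists e. intros z [_ Hz]. apply He, Hz. }
      exists N. intros n Hn.
      assert (K : P (Im (sum_n (G := C_AbelianMonoid) u n))) by exact (HN n Hn).
      rewrite sum_n_C in K. exact K.
  - intros [H1 H2] P [e He].
    destruct (H1 (ball (Re l) e)) as [N1 HN1]; [now exists e|].
    destruct (H2 (ball (Im l) e)) as [N2 HN2]; [now exists e|].
    exists (N1 + N2)%nat. intros n Hn. apply He.
    change (ball (M := C_NormedModule) l e (sum_n (G := C_AbelianMonoid) u n)).
    rewrite sum_n_C. split; [apply HN1|apply HN2]; lia.
Qed.

Lemma Cis_series_head (u : nat -> C) :
  (forall n, u (S n) = 0) -> Cis_series u (u 0%nat).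
Proof.
  intros Hu. apply is_series_decr_1.
  match goal with |- is_series _ ?x => replace x with (RtoC 0) end.
  2:{ change (RtoC 0 = u 0%nat + - u 0%nat). ring. }
  apply is_series_ext with (fun _ => RtoC 0); [easy|].
  assert (Z : is_series (fun _ : nat => 0%R) 0%R).
  { apply is_series_Reals. intros e He. exists 0%nat. intros n _.
    replace (sum_f_R0 (fun _ => 0%R) n) with 0%R.
    - now rewrite R_dist_eq.
    - induction n as [|n IH]; [easy|]. simpl. rewrite <- IH. ring. }
  now apply Cis_series_components.
Qed.

Lemma Cis_series_unique (u : nat -> C) (l l' : C) :
  Cis_series u l -> Cis_series u l' -> l = l'.
Proof. intros H H'. exact (filterlim_locally_unique _ _ _ H H'). Qed.

Lemma CSeries_unique (u : nat -> C) (l : C) :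
  Cis_series u l -> CSeries u = l.
Proof.
  intros H. refine (iota_unique (V := C_CompleteNormedModule) _ l _ H).
  intros y Hy. exact (Cis_series_unique _ _ _ Hy H).
Qed.

(** Completeness of [C] turns absolute convergence into convergence, which makes the [iota] value
    meaningful. *)
Lemma CSeries_correct (u : nat -> C) :
  ex_series (fun n => Cmod (u n)) -> Cis_series u (CSeries u).
Proof.
  intros H.
  destruct (ex_series_le (V := C_CompleteNormedModule) u (fun n => Cmod (u n))) as [l Hl].
  - intros n. apply Rle_refl.
  - exact H.
  - rewrite (CSeries_unique u l); exact Hl.
Qed.

Lemma Cmod_sum_n_le (u : nat -> C) (n : nat) :
  (Cmod (sum_n (G := C_AbelianMonoid) u n) <= sum_n (fun k => Cmod (u k)) n)%R.
Proof.
  induction n as [|n IH].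
  - rewrite !sum_O. apply Rle_refl.
  - rewrite !sum_Sn. eapply Rle_trans; [apply Cmod_triangle|].
    apply Rplus_le_compat_r, IH.
Qed.

Lemma Cis_series_norm_le (u : nat -> C) (l : C) :
  Cis_series u l -> ex_series (fun n => Cmod (u n)) ->
  (Cmod l <= Series (fun n => Cmod (u n)))%R.
Proof.
  intros H E. apply Series_correct in E.
  apply (is_lim_seq_le (fun n => Cmod (sum_n (G := C_AbelianMonoid) u n)) 
     (sum_n (fun n => Cmod (u n))) (Cmod l) (Series (fun n => Cmod (u n)))).
  - intros n. apply Cmod_sum_n_le.
  - apply (filterlim_comp _ _ _ _ (@norm C_AbsRing C_NormedModule) _
             (locally (l : C_NormedModule)) _).
    exact H. exact (filterlim_norm (V := C_NormedModule) l).
  - exact E.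
Qed.

(** The remainder is at most e |s - z| once |s - z| <= e / (|M| + 1). [M] has no prescribed sign,
    hence the absolute value; the 1 keeps the quotient defined at M = 0. *)
Lemma Cis_derive_quadratic (f : C -> C) (z l : C) (d M : R) :
  (0 < d)%R ->
  (forall s, (Cmod (s - z) < d)%R ->
     (Cmod (f s - f z - l * (s - z)) <= M * Cmod (s - z) ^ 2)%R) ->
  Cis_derive f z l.
Proof.
  intros Hd H. split.
  - apply is_linear_scal_l.
  - intros x Hx. assert (Ex : z = x)
      by exact (is_filter_lim_locally_unique
                  (V := AbsRing_NormedModule C_AbsRing) z x Hx).
    subst x.
    intros [e He]. simpl.
    assert (HM : (0 < Rabs M + 1)%R) by (generalize (Rabs_pos M); lra).
    assert (Hd' : (0 < Rmin d (e / (Rabs M + 1)))%R).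
    { apply Rmin_pos; [lra|]. now apply Rdiv_lt_0_compat. }
    exists (mkposreal _ Hd'). intros s Hs.
    change (Cmod (s - z) < Rmin d (e / (Rabs M + 1)))%R in Hs.
    change (Cmod (f s - f z - (s - z) * l) <= e * Cmod (s - z))%R.
    rewrite (Cmult_comm (s - z)).
    eapply Rle_trans; [apply H; eapply Rlt_le_trans; [exact Hs|apply Rmin_l]|].
    assert (H2 := Rlt_le_trans _ _ _ Hs (Rmin_r _ _)).
    assert (H0 := Cmod_ge_0 (s - z)).
    replace (M * Cmod (s-z)^2)%R with (M * Cmod (s - z) * Cmod (s-z))%R by ring.
    apply Rmult_le_compat_r; [easy|].
    apply Rle_trans with ((Rabs M + 1) * Cmod (s - z))%R.
    + apply Rmult_le_compat_r; [easy|]. generalize (Rle_abs M); lra.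
    + rewrite Rmult_comm. apply Rlt_le, Rlt_div_r; lra.
Qed.

(* The two normed-module structures on [C] over itself carry the same norm but
   are not convertible. *)
Lemma Cis_derive_AbsRing (f : C -> C) (z l : C) :
  Cis_derive f z l <->
  is_derive (K := C_AbsRing) (V := AbsRing_NormedModule C_AbsRing) f z l.
Proof. split; intros [_ H]; (split; [apply is_linear_scal_l | exact H]). Qed.

Lemma Cis_derive_comp (f g : C -> C) (z df dg : C) :
  Cis_derive f (g z) df -> Cis_derive g z dg ->
  Cis_derive (fun s => f (g s)) z (dg * df).
Proof.
  intros Hf Hg. apply Cis_derive_AbsRing in Hg.
  exact (is_derive_comp (K := C_AbsRing) (V := C_NormedModule) f g z df dg Hf Hg).
Qed.

Lemma Cis_derive_mult (f g : C -> C) (z df dg : C) :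
  Cis_derive f z df -> Cis_derive g z dg ->
  Cis_derive (fun s => f s * g s) z (df * g z + f z * dg).
Proof.
  rewrite !Cis_derive_AbsRing. intros Hf Hg.
  exact (is_derive_mult (K := C_AbsRing) f g z df dg Hf Hg Cmult_comm).
Qed.

Lemma Cis_derive_C_derive (f : C -> C) (z l : C) : Cis_derive f z l -> C_derive f z = l.
Proof. apply is_C_derive_unique. Qed.

(** Restriction to the real line through 0 and [z] leads to functions of one real variable, where a
    vanishing derivative yields constancy. *)
Lemma Cis_derive_line (f : C -> C) (z l : C) (s : R) :
  Cis_derive f (RtoC s * z) l ->
  is_derive (V := C_R_NormedModule) (fun x : R => f (RtoC x * z)) s (z * l).
Proof.
  intros [_ H]. split; [apply is_linear_scal_l|].
  intros x Hx. assert (Ex : s = x)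
    by exact (is_filter_lim_locally_unique
                (V := AbsRing_NormedModule R_AbsRing) s x Hx).
  subst x. clear Hx.
  specialize (H (RtoC s * z) (fun P HP => HP)).
  intros [e He].
  assert (HM : (0 < Cmod z + 1)%R) by (generalize (Cmod_ge_0 z); lra).
  (* A step x - s in the parameter moves the argument by |x - s| |z|; division by |z| + 1 absorbs
     this factor, also for z = 0. *)
  assert (He' : (0 < e / (Cmod z + 1))%R) by now apply Rdiv_lt_0_compat.
  destruct (H (mkposreal _ He')) as [[d Hd] Hb].
  assert (Hd' : (0 < d / (Cmod z + 1))%R) by now apply Rdiv_lt_0_compat.
  exists (mkposreal _ Hd'). intros x Hx.
  change (Rabs (x - s) < d / (Cmod z + 1))%R in Hx.
  assert (Es : (RtoC x * z - RtoC s * z)%C = RtoC (x - s) * z) by (rewrite RtoC_minus; ring).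
  assert (Em : Cmod (RtoC x * z - RtoC s * z)%C = (Rabs (x - s) * Cmod z)%R).
  { rewrite Es, Cmod_mult, Cmod_R. easy. }
  specialize (Hb (RtoC x * z)).
  change ((Cmod (RtoC x * z - RtoC s * z) < d)%R ->
    (Cmod (f (RtoC x * z)%C - f (RtoC s * z)%C - (RtoC x * z - RtoC s * z) * l)
     <= e / (Cmod z + 1) * Cmod (RtoC x * z - RtoC s * z))%R) in Hb.
  rewrite Em in Hb.
  assert (H0 := Rabs_pos (x - s)). assert (H1 := Cmod_ge_0 z).
  assert (Ez : scal (V := C_R_NormedModule) (x - s)%R (z * l)
               = (RtoC x * z - RtoC s * z) * l).
  { rewrite Es, <- Cmult_assoc. apply scal_R_Cmult. }
  match goal with |- (norm ?u <= _)%R =>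
    replace (norm u) with
      (Cmod (f (RtoC x * z)%C - f (RtoC s * z)%C - (RtoC x * z - RtoC s * z) * l))
  end.
  2:{ rewrite Cmod_norm, <- Ez. reflexivity. }
  change (norm (minus x s)) with (Rabs (x - s)).
  change (pos (mkposreal e He)) with e.
  eapply Rle_trans; [apply Hb|].
  - apply Rle_lt_trans with (Rabs (x - s) * (Cmod z + 1))%R; [nra|].
    apply Rlt_div_r in Hx; lra.
  - replace (e / (Cmod z + 1) * (Rabs (x - s) * Cmod z))%R
      with (e * Rabs (x-s) * (Cmod z / (Cmod z + 1)))%R by (field; lra).
    rewrite <- (Rmult_1_r (e * Rabs (x - s))) at 2.
    apply Rmult_le_compat_l; [nra|]. apply Rle_div_l; lra.
Qed.

(** The segment from 0 to [t] stays in the disc, and along it the derivative in the real parameter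
    vanishes. *)
Lemma Cderive_zero_constant (f : C -> C) (r : R) :
  (forall t, (Cmod t < r)%R -> Cis_derive f t 0) ->
  forall t, (Cmod t < r)%R -> f t = f 0.
Proof.
  intros H t Ht.
  assert (E := eq_is_derive (V := C_R_NormedModule) (fun x : R => f (RtoC x * t)) 0 1).
  simpl in E. rewrite Cmult_0_l, Cmult_1_l in E. symmetry; apply E; [|lra].
  intros x Hx. replace (@zero C_R_NormedModule) with (t * 0) by apply Cmult_0_r.
  apply Cis_derive_line, H. rewrite Cmod_mult, Cmod_R, Rabs_right by lra.
  generalize (Cmod_ge_0 t); nra.
Qed.

(** * Complex power series *)

(** Absolute convergence is a separate clause because products and termwise derivatives rely on it.
    [f] is constrained only inside the disc, so any function agreeing with it there may take its
    place. *)
Definition is_psum (r : R) (a : nat -> C) (f : C -> C) : Prop :=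
  (forall x : R, (0 <= x < r)%R -> ex_series (fun n => (Cmod (a n) * x ^ n)%R)) /\
  (forall t : C, (Cmod t < r)%R -> Cis_series (fun n => a n * t ^ n) (f t)).

Definition Cderive_coef (a : nat -> C) (n : nat) : C :=
  RtoC (INR (S n)) * a (S n).

Definition conv (a b : nat -> C) (n : nat) : C :=
  sum_n (G := C_AbelianMonoid) (fun k => a k * b (n - k)%nat) n.

Lemma ex_series_Cmod_term (a : nat -> C) (t : C) :
  ex_series (fun n => Cmod (a n) * Cmod t ^ n)%R ->
  ex_series (fun n => Cmod (a n * t ^ n)).
Proof.
  apply ex_series_ext. intros n. now rewrite Cmod_mult, Cmod_pow.
Qed.

Lemma is_psum_CSeries (r : R) (a : nat -> C) :
  (forall x : R, (0 <= x < r)%R -> ex_series (fun n => (Cmod (a n) * x ^ n)%R)) ->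
  is_psum r a (fun t => CSeries (fun n => a n * t ^ n)).
Proof.
  intros H. split; [exact H|]. intros t Ht. apply CSeries_correct.
  apply ex_series_Cmod_term, H. split; [apply Cmod_ge_0|easy].
Qed.

Lemma is_psum_ext (r : R) (a b : nat -> C) (f g : C -> C) :
  (forall n, a n = b n) -> (forall t, (Cmod t < r)%R -> f t = g t) ->
  is_psum r a f -> is_psum r b g.
Proof.
  intros Hab Hfg [H1 H2]. split.
  - intros x Hx. apply ex_series_ext with (2 := H1 x Hx). intros n. now rewrite Hab.
  - intros t Ht. rewrite <- Hfg by easy.
    apply is_series_ext with (2 := H2 t Ht). intros n. now rewrite Hab.
Qed.

Lemma is_psum_le (r r' : R) (a : nat -> C) (f : C -> C) :
  (r' <= r)%R -> is_psum r a f -> is_psum r' a f.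
Proof. intros Hr [H1 H2]. split; intros; [apply H1|apply H2]; lra. Qed.

(** Formal differentiation preserves the radius of convergence; convergence at the midpoint of [x]
    and [r] shows that this radius exceeds [x]. *)
Lemma ex_series_derive (u : nat -> R) (r : R) :
  (forall x : R, (0 <= x < r)%R -> ex_series (fun n => (Rabs (u n) * x ^ n)%R)) ->
  forall x : R, (0 <= x < r)%R ->
    ex_series (fun n => (Rabs (PS_derive u n) * x ^ n)%R).
Proof.
  intros H x Hx.
  apply ex_series_ext with (fun n => Rabs (PS_derive u n * x ^ n)).
  { intros n. rewrite Rabs_mult, (Rabs_right (x ^ n)); [easy|].
    apply Rle_ge, pow_le; lra. }
  apply CV_disk_inside. rewrite CV_radius_derive.
  apply Rbar_lt_le_trans with ((x + r) / 2)%R.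
  { rewrite Rabs_right by lra. simpl. lra. }
  apply (Lub_Rbar_correct (CV_disk u)). unfold CV_disk.
  apply ex_series_ext with (2 := H ((x + r) / 2)%R ltac:(lra)).
  intros n. rewrite Rabs_mult, (Rabs_right (_ ^ n)); [easy|].
  apply Rle_ge, pow_le; lra.
Qed.

Lemma ex_series_Cderive_coef (a : nat -> C) (r : R) :
  (forall x : R, (0 <= x < r)%R -> ex_series (fun n => (Cmod (a n) * x ^ n)%R)) ->
  forall x : R, (0 <= x < r)%R ->
    ex_series (fun n => (Cmod (Cderive_coef a n) * x ^ n)%R).
Proof.
  intros H x Hx.
  assert (E : forall n, Rabs (Cmod (a n)) = Cmod (a n)).
  { intros n. apply Rabs_right, Rle_ge, Cmod_ge_0. }
  apply ex_series_ext with (fun n => Rabs (PS_derive (fun k => Cmod (a k)) n) * x ^ n)%R.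
  - intros n. unfold PS_derive, Cderive_coef.
    now rewrite Rabs_mult, Cmod_mult, Cmod_R, E.
  - apply ex_series_derive with r; [|easy]. intros y Hy.
    apply ex_series_ext with (2 := H y Hy). intros n. now rewrite E.
Qed.

(** Induction through R_(n+1) = s R_n + n t^(n-1) (s - t)^2, where R_n is the expression under the
    first [Cmod]. Truncated subtraction is harmless: for n = 0 and n = 1 a factor n or n - 1
    vanishes. *)
Lemma pow_taylor_remainder (s t : C) (rho : R) (n : nat) :
  (Cmod s <= rho)%R -> (Cmod t <= rho)%R ->
  (Cmod (s ^ n - t ^ n - RtoC (INR n) * t ^ (n - 1) * (s - t))
   <= INR n * INR (n - 1) * rho ^ (n - 2) * Cmod (s - t) ^ 2)%R.
Proof.
  intros Hs Ht. assert (H0 := Cmod_ge_0 s).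
  assert (Hd := pow2_ge_0 (Cmod (s - t))).
  destruct n as [|n].
  { replace (s ^ 0 - t ^ 0 - RtoC (INR 0) * t ^ (0 - 1) * (s - t)) with (RtoC 0) by (simpl; ring).
    rewrite Cmod_0. simpl. lra. }
  induction n as [|n IH].
  { replace (s ^ 1 - t ^ 1 - RtoC (INR 1) * t ^ (1 - 1) * (s - t)) with (RtoC 0) by (simpl; ring).
    rewrite Cmod_0. simpl. lra. }
  replace (S (S n) - 1)%nat with (S n) by lia.
  replace (S (S n) - 2)%nat with n by lia.
  replace (S n - 1)%nat with n in IH by lia.
  replace (s ^ S (S n) - t ^ S (S n) - RtoC (INR (S (S n))) * t ^ S n * (s - t))
    with (s * (s ^ S n - t ^ S n - RtoC (INR (S n)) * t ^ n * (s - t))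
          + RtoC (INR (S n)) * t ^ n * (s - t) ^ 2).
  2:{ rewrite (S_INR (S n)), RtoC_plus. simpl Cpow. ring. }
  eapply Rle_trans; [apply Cmod_triangle|].
  rewrite !Cmod_mult, !Cmod_pow, Cmod_R, (Rabs_right (INR _)) by apply Rle_ge, pos_INR.
  assert (Hn := pos_INR n).
  assert (Hp : (0 <= rho ^ n)%R) by (apply pow_le; lra).
  (* For n = 0 truncation gives the exponent 0 instead of -1; the factor [INR n] saves the
     identity. *)
  assert (Hq : (rho * (INR n * rho ^ (S n - 2)) = INR n * rho ^ n)%R).
  { destruct n; [simpl; ring|]. replace (S (S n) - 2)%nat with n by lia. simpl; ring. }
  assert (Ht' : (Cmod t ^ n <= rho ^ n)%R) by (apply pow_incr; split; [apply Cmod_ge_0|easy]).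
  rewrite !S_INR in *.
  set (D := (Cmod (s - t) ^ 2)%R) in *. clearbody D.
  apply Rle_trans with (rho * ((INR n + 1) * INR n * rho ^ (S n - 2) * D)
       + (INR n + 1) * rho ^ n * D)%R.
  - apply Rplus_le_compat.
    + apply Rmult_le_compat; try easy. apply Cmod_ge_0.
    + apply Rmult_le_compat_r; [easy|]. apply Rmult_le_compat_l; lra.
  - replace (rho * ((INR n + 1) * INR n * rho ^ (S n - 2) * D))%R
      with ((INR n + 1) * D * (rho * (INR n * rho ^ (S n - 2))))%R by ring.
    rewrite Hq.
    assert (0 <= (INR n + 1) * D * rho ^ n)%R by (repeat apply Rmult_le_pos; lra).
    lra.
Qed.

(** The Taylor remainders of the powers are summed: the error is at most |s - t|^2 times the sum of
    |a_n| n (n - 1) rho^(n-2), finite because the second formal derivative converges absolutely at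
    rho. *)
Lemma is_psum_derive_at (r : R) (a : nat -> C) (f : C -> C) (t : C) :
  is_psum r a f -> (Cmod t < r)%R ->
  Cis_derive f t (CSeries (fun n => Cderive_coef a n * t ^ n)).
Proof.
  intros [H1 H2] Ht. assert (Ht0 := Cmod_ge_0 t).
  assert (D1 := ex_series_Cderive_coef a r H1).
  assert (D2 := ex_series_Cderive_coef _ r D1).
  destruct (is_psum_CSeries r _ D1) as [_ S1]. specialize (S1 t Ht). simpl in S1.
  set (l := CSeries (fun n => Cderive_coef a n * t ^ n)) in *.
  (* A radius strictly between |t| and r: one bound then covers all s within rho - |t| of t. *)
  set (rho := ((Cmod t + r) / 2)%R).
  assert (Hrho : (Cmod t < rho < r)%R) by (unfold rho; lra).
  assert (D2' : ex_series (fun n => (Cmod (a n) * (INR n * INR (n - 1) * rho ^ (n - 2)))%R)).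
  { apply ex_series_incr_1, ex_series_incr_1.
    apply ex_series_ext with (2 := D2 rho ltac:(lra)). intros n.
    unfold Cderive_coef. rewrite !Cmod_mult, !Cmod_R, !(Rabs_right (INR _))
      by apply Rle_ge, pos_INR.
    replace (S (S n) - 1)%nat with (S n) by lia. replace (S (S n) - 2)%nat with n by lia.
    as_real_eq. ring. }
  apply (Cis_derive_quadratic f t l (rho - Cmod t)
           (Series (fun n => (Cmod (a n) * (INR n * INR (n - 1) * rho ^ (n - 2)))%R))); [lra|].
  intros s Hs.
  assert (Hsr : (Cmod s < rho)%R).
  { replace s with ((s - t) + t) by ring. eapply Rle_lt_trans; [apply Cmod_triangle|]. lra. }
  (* The derivative series is reindexed so that it can be subtracted termwise; its term n = 0
     vanishes. *)
  assert (S1' : Cis_series (fun n => a n * (RtoC (INR n) * t ^ (n - 1))) l).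
  { apply is_series_decr_1.
    match goal with |- is_series _ ?x => replace x with l end.
    2:{ change (l = l + - (a 0%nat * (RtoC (INR 0) * t ^ (0 - 1)))). simpl. ring. }
    apply is_series_ext with (2 := S1). intros n. unfold Cderive_coef.
    replace (S n - 1)%nat with n by lia. as_complex_eq. ring. }
  assert (Sd : Cis_series
    (fun n => a n * (s ^ n - t ^ n - RtoC (INR n) * t ^ (n - 1) * (s - t)))
    (f s - f t - l * (s - t))).
  { assert (K := is_series_minus _ _ _ _ (is_series_minus _ _ _ _ (H2 s ltac:(lra)) (H2 t Ht))
       (is_series_scal (s - t) _ _ S1')).
    match type of K with is_series _ ?x => replace x with (f s - f t - l * (s - t)) in K end.
    2:{ change (f s - f t - l * (s - t) = f s - f t - (s - t) * l). ring. }
    apply is_series_ext with (2 := K). intros n.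
    change (a n * s ^ n - a n * t ^ n - (s - t) * (a n * (RtoC (INR n) * t ^ (n - 1)))
     = a n * (s ^ n - t ^ n - RtoC (INR n) * t ^ (n - 1) * (s - t))). ring. }
  assert (B : forall n, (0 <= Cmod (a n * (s ^ n - t ^ n - RtoC (INR n) * t ^ (n - 1) * (s - t)))
     <= Cmod (a n) * (INR n * INR (n - 1) * rho ^ (n - 2)) * Cmod (s - t) ^ 2)%R).
  { intros n. split; [apply Cmod_ge_0|]. rewrite Cmod_mult, Rmult_assoc.
    apply Rmult_le_compat_l; [apply Cmod_ge_0|].
    apply pow_taylor_remainder; lra. }
  assert (E := ex_series_scal_r (Cmod (s - t) ^ 2)%R _ D2').
  eapply Rle_trans; [apply (Cis_series_norm_le _ _ Sd)|].
  - apply (ex_series_le (V := R_CompleteNormedModule)) with (2 := E).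
    intros n. change (Rabs (Cmod (a n * (s ^ n - t ^ n - RtoC (INR n) * t ^ (n - 1) * (s - t))))
     <= Cmod (a n) * (INR n * INR (n - 1) * rho ^ (n - 2)) * Cmod (s - t) ^ 2)%R.
    rewrite Rabs_right by apply Rle_ge, B. apply B.
  - rewrite <- Series_scal_r. apply Series_le; [exact B|exact E].
Qed.

Lemma is_psum_C_derive (r : R) (a : nat -> C) (f : C -> C) :
  is_psum r a f -> is_psum r (Cderive_coef a) (C_derive f).
Proof.
  intros H. apply is_psum_ext with
    (3 := is_psum_CSeries r _ (ex_series_Cderive_coef a r (proj1 H))).
  - easy.
  - intros t Ht. symmetry. apply Cis_derive_C_derive. now apply is_psum_derive_at with r.
Qed.

Lemma is_psum_C_derive_n (r : R) (a : nat -> C) (f : C -> C) (n : nat) :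
  is_psum r a f -> is_psum r (Nat.iter n Cderive_coef a) (C_derive_n f n).
Proof. intros H. induction n as [|n IH]; [exact H|]. apply is_psum_C_derive, IH. Qed.

Lemma is_psum_at_0 (r : R) (a : nat -> C) (f : C -> C) :
  (0 < r)%R -> is_psum r a f -> f 0 = a 0%nat.
Proof.
  intros Hr [_ H]. apply Cis_series_unique with (fun n => a n * 0 ^ n).
  { apply H. now rewrite Cmod_0. }
  replace (a 0%nat) with ((fun n => a n * 0 ^ n) 0%nat) by (simpl; ring).
  apply Cis_series_head. intros n. simpl. ring.
Qed.

(** The factorials are cross-multiplied to avoid division, and k is general because each
    differentiation raises the index; k = 0 gives the Taylor coefficients. *)
Lemma iter_Cderive_coef (a : nat -> C) (n k : nat) :
  RtoC (INR (fact k)) * Nat.iter n Cderive_coef a k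
  = RtoC (INR (fact (n + k))) * a (n + k)%nat.
Proof.
  revert k. induction n as [|n IH]; intros k; [easy|].
  simpl Nat.iter. unfold Cderive_coef at 1.
  rewrite Cmult_assoc, <- RtoC_mult, <- mult_INR, Nat.mul_comm.
  change (S k * fact k)%nat with (fact (S k)).
  rewrite IH. now replace (n + S k)%nat with (S n + k)%nat by lia.
Qed.

Lemma is_psum_taylor (r : R) (a : nat -> C) (f : C -> C) (n : nat) :
  (0 < r)%R -> is_psum r a f ->
  C_derive_n f n 0 = RtoC (INR (fact n)) * a n.
Proof.
  intros Hr H. rewrite (is_psum_at_0 r _ _ Hr (is_psum_C_derive_n r a f n H)).
  assert (K := iter_Cderive_coef a n 0). rewrite Nat.add_0_r in K.
  rewrite <- K. simpl. ring.
Qed.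

(** * Cauchy products, multiples and shifts of power series *)

Lemma Re_conv (a b : nat -> C) (n : nat) :
  Re (conv a b n)
  = (sum_f_R0 (fun k => Re (a k) * Re (b (n - k)%nat)) n
     - sum_f_R0 (fun k => Im (a k) * Im (b (n - k)%nat)) n)%R.
Proof.
  unfold conv. rewrite sum_n_C. simpl Re. rewrite sum_n_Reals.
  apply minus_sum.
Qed.

Lemma Im_conv (a b : nat -> C) (n : nat) :
  Im (conv a b n)
  = (sum_f_R0 (fun k => Re (a k) * Im (b (n - k)%nat)) n
     + sum_f_R0 (fun k => Im (a k) * Re (b (n - k)%nat)) n)%R.
Proof.
  unfold conv. rewrite sum_n_C. simpl Im. rewrite sum_n_Reals.
  apply plus_sum.
Qed.

Lemma im_le_Cmod (c : C) : (Rabs (Im c) <= Cmod c)%R.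
Proof. eapply Rle_trans; [|apply Rmax_Cmod]. apply Rmax_r. Qed.

Lemma ex_series_Rabs_le (u : nat -> C) (v : nat -> R) :
  (forall n, Rabs (v n) <= Cmod (u n))%R -> ex_series (fun n => Cmod (u n)) ->
  ex_series (fun n => Rabs (v n)).
Proof.
  intros H. apply (ex_series_le (V := R_CompleteNormedModule)). intros n.
  change (Rabs (Rabs (v n)) <= Cmod (u n))%R. now rewrite Rabs_Rabsolu.
Qed.

(** The real Cauchy product theorem is applied to the four products of real and imaginary parts,
    whose series converge absolutely since |Re c| and |Im c| are at most |c|. *)
Lemma Cis_series_mult (a b : nat -> C) (la lb : C) :
  Cis_series a la -> Cis_series b lb ->
  ex_series (fun n => Cmod (a n)) -> ex_series (fun n => Cmod (b n)) ->
  Cis_series (conv a b) (la * lb).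
Proof.
  rewrite !Cis_series_components. intros [Ha1 Ha2] [Hb1 Hb2] Ea Eb.
  assert (Ea1 := ex_series_Rabs_le a _ (fun n => re_le_Cmod (a n)) Ea).
  assert (Ea2 := ex_series_Rabs_le a _ (fun n => im_le_Cmod (a n)) Ea).
  assert (Eb1 := ex_series_Rabs_le b _ (fun n => re_le_Cmod (b n)) Eb).
  assert (Eb2 := ex_series_Rabs_le b _ (fun n => im_le_Cmod (b n)) Eb).
  split.
  - eapply is_series_ext; [intros n; symmetry; apply Re_conv|].
    apply (is_series_minus _ _ _ _ (is_series_mult _ _ _ _ Ha1 Hb1 Ea1 Eb1)
      (is_series_mult _ _ _ _ Ha2 Hb2 Ea2 Eb2)).
  - eapply is_series_ext; [intros n; symmetry; apply Im_conv|].
    apply (is_series_plus _ _ _ _ (is_series_mult _ _ _ _ Ha1 Hb2 Ea1 Eb2)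
      (is_series_mult _ _ _ _ Ha2 Hb1 Ea2 Eb1)).
Qed.

Lemma is_psum_mult (r : R) (a b : nat -> C) (f g : C -> C) :
  is_psum r a f -> is_psum r b g ->
  is_psum r (conv a b) (fun t => f t * g t).
Proof.
  intros [Ha Hf] [Hb Hg]. split.
  - intros x Hx.
    destruct (Ha x Hx) as [la Hla]. destruct (Hb x Hx) as [lb Hlb].
    assert (P : forall c : nat -> C, forall n, (0 <= Cmod (c n) * x ^ n)%R).
    { intros c n. apply Rmult_le_pos; [apply Cmod_ge_0|]. apply pow_le; lra. }
    (* The Cauchy product of the two series of moduli dominates the moduli of the convolution. *)
    apply (ex_series_le (V := R_CompleteNormedModule)) with
      (2 := ex_intro _ _ (is_series_mult_pos _ _ _ _ Hla Hlb (P a) (P b))).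
    intros n. change (Rabs (Cmod (conv a b n) * x ^ n) <=
       sum_f_R0 (fun k => Cmod (a k) * x ^ k * (Cmod (b (n - k)%nat) * x ^ (n - k))) n)%R.
    rewrite Rabs_right by apply Rle_ge, P.
    rewrite (sum_eq _ (fun k => (Cmod (a k * b (n - k)%nat)) * x ^ n)%R).
    2:{ intros k Hk. rewrite Cmod_mult. replace (x ^ n)%R with (x ^ k * x ^ (n - k))%R; [ring|].
        rewrite <- pow_add. f_equal. lia. }
    rewrite <- scal_sum, Rmult_comm.
    apply Rmult_le_compat_l; [apply pow_le; lra|].
    rewrite <- sum_n_Reals. apply Cmod_sum_n_le.
  - intros t Ht. assert (Ht0 := Cmod_ge_0 t).
    apply is_series_ext with (conv (fun n => a n * t ^ n) (fun n => b n * t ^ n)).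
    + intros n. unfold conv.
      rewrite <- (sum_n_mult_r (K := C_Ring) (t ^ n) (fun k => a k * b (n - k)%nat)).
      apply sum_n_ext_loc. intros k Hk.
      change (a k * t ^ k * (b (n - k)%nat * t ^ (n - k)) = a k * b (n - k)%nat * t ^ n).
      replace (t ^ n) with (t ^ k * t ^ (n - k)); [ring|].
      rewrite <- Cpow_add_r. f_equal. lia.
    + apply Cis_series_mult; [apply Hf, Ht|apply Hg, Ht| |];
        apply ex_series_Cmod_term; [apply Ha|apply Hb]; lra.
Qed.

Lemma is_psum_scal (r : R) (c : C) (a : nat -> C) (f : C -> C) :
  is_psum r a f -> is_psum r (fun n => c * a n) (fun t => c * f t).
Proof.
  intros [H1 H2]. split.
  - intros x Hx. apply ex_series_ext with (fun n => Cmod c * (Cmod (a n) * x ^ n))%R.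
    + intros n. rewrite Cmod_mult. as_real_eq. ring.
    + apply (ex_series_scal_l (K := R_AbsRing) (V := R_NormedModule)), H1, Hx.
  - intros t Ht. assert (K := is_series_scal c _ _ (H2 t Ht)).
    apply is_series_ext with (2 := K). intros n.
    change (c * (a n * t ^ n) = c * a n * t ^ n). ring.
Qed.

(** Division of f - a_0 by t with a quotient that is also a power series at t = 0: this removes the
    singularities. *)
Lemma is_psum_shift (r : R) (a : nat -> C) (f : C -> C) :
  is_psum r a f ->
  exists g, is_psum r (fun n => a (S n)) g /\
    forall t, (Cmod t < r)%R -> f t = a 0%nat + t * g t.
Proof.
  intros [H1 H2].
  assert (E : forall x : R, (0 <= x < r)%R -> ex_series (fun n => (Cmod (a (S n)) * x ^ n)%R)).
  (* Dividing the series at x by x would fail for x = 0; comparison with the formal derivative,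
     whose factor n + 1 is at least 1, covers every x. *)
  { intros x Hx. apply (ex_series_le (V := R_CompleteNormedModule)) with
      (2 := ex_series_Cderive_coef a r H1 x Hx).
    intros n. unfold Cderive_coef.
    change (Rabs (Cmod (a (S n)) * x ^ n) <= Cmod (RtoC (INR (S n)) * a (S n)) * x ^ n)%R.
    assert (P : (0 <= Cmod (a (S n)) * x ^ n)%R).
    { apply Rmult_le_pos; [apply Cmod_ge_0|]. apply pow_le; lra. }
    rewrite Rabs_right by lra.
    rewrite Cmod_mult, Cmod_R, Rabs_right by apply Rle_ge, pos_INR.
    rewrite S_INR. generalize (pos_INR n). nra. }
  assert (G := is_psum_CSeries r _ E).
  eexists; split; [exact G|]. destruct G as [_ G]. intros t Ht.
  apply Cis_series_unique with (1 := H2 t Ht).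
  apply is_series_decr_1.
  assert (K := is_series_scal t _ _ (G t Ht)). simpl in K.
  match type of K with is_series _ ?x =>
    match goal with |- is_series _ ?y => replace y with x end end.
  2:{ set (g := CSeries _).
      change (t * g = a 0%nat + t * g + - (a 0%nat * 1)). ring. }
  apply is_series_ext with (2 := K). intros n.
  change (t * (a (S n) * t ^ n) = a (S n) * (t * t ^ n)). ring.
Qed.

Lemma ex_series_bounded_coef (a : nat -> C) :
  (forall n, (Cmod (a n) <= 1)%R) ->
  forall x : R, (0 <= x < 1)%R -> ex_series (fun n => (Cmod (a n) * x ^ n)%R).
Proof.
  intros H x Hx.
  apply (ex_series_le (V := R_CompleteNormedModule)) with (fun n => x ^ n)%R.
  - intros n. change (Rabs (Cmod (a n) * x ^ n) <= x ^ n)%R.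
    assert (P := pow_le x n (proj1 Hx)). assert (Q := Cmod_ge_0 (a n)).
    rewrite Rabs_right by nra. specialize (H n). nra.
  - eexists. apply is_series_geom. rewrite Rabs_right; lra.
Qed.


(** * The exponential series *)

Definition exp_coef (n : nat) : C := RtoC (/ INR (fact n)).

Lemma Cderive_exp_coef (n : nat) : Cderive_coef exp_coef n = exp_coef n.
Proof.
  unfold Cderive_coef, exp_coef. rewrite <- RtoC_mult. f_equal.
  change (fact (S n)) with (S n * fact n)%nat. rewrite mult_INR.
  field. split; [apply INR_fact_neq_0|apply not_0_INR; lia].
Qed.

Lemma ex_series_exp_coef (x : R) : ex_series (fun n => (Cmod (exp_coef n) * x ^ n)%R).
Proof.
  exists (exp x). apply is_series_ext with (2 := is_exp_Reals x).
  intros n. unfold exp_coef. rewrite Cmod_R, Rabs_right.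
  - rewrite pow_n_pow. apply Rmult_comm.
  - apply Rle_ge, Rlt_le, Rinv_0_lt_compat, INR_fact_lt_0.
Qed.

Lemma is_derive_Re (F : R -> C) (s : R) (l : C) :
  is_derive (V := C_R_NormedModule) F s l -> is_derive (fun x => Re (F x)) s (Re l).
Proof.
  intros H.
  exact (filterdiff_comp' (W := R_NormedModule) F (fst : C_R_NormedModule -> R_NormedModule) s _ _ H
    (filterdiff_linear _ (is_linear_fst (U := R_NormedModule) (V := R_NormedModule)))).
Qed.

Lemma is_derive_Im (F : R -> C) (s : R) (l : C) :
  is_derive (V := C_R_NormedModule) F s l -> is_derive (fun x => Im (F x)) s (Im l).
Proof.
  intros H.
  exact (filterdiff_comp' (W := R_NormedModule) F (snd : C_R_NormedModule -> R_NormedModule) s _ _ H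
    (filterdiff_linear _ (is_linear_snd (U := R_NormedModule) (V := R_NormedModule)))).
Qed.

(* Along each ray the derivative of [cexp (- s z) * E (s z)] vanishes, where [E] is the
   sum of the series; this is checked on real and imaginary parts. *)
Lemma is_psum_cexp (r : R) : is_psum r exp_coef cexp.
Proof.
  assert (P : forall r, is_psum r exp_coef (fun t => CSeries (fun n => exp_coef n * t ^ n))).
  { intros r'. apply is_psum_CSeries. intros x _. apply ex_series_exp_coef. }
  apply is_psum_ext with (3 := P r); [easy|]. intros z _.
  set (E := fun t => CSeries (fun n => exp_coef n * t ^ n)) in *.
  assert (D : forall t, Cis_derive E t (E t)).
  { intros t. replace (E t) with (CSeries (fun n => Cderive_coef exp_coef n * t ^ n)).
    - apply is_psum_derive_at with (Cmod t + 1)%R; [apply P|lra].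
    - apply CSeries_unique. apply is_series_ext with (fun n => exp_coef n * t ^ n).
      + intros n. now rewrite Cderive_exp_coef.
      + apply (P (Cmod t + 1)%R). lra. }
  set (a := fun s : R => Re (E (RtoC s * z))).
  set (b := fun s : R => Im (E (RtoC s * z))).
  set (x := Re z). set (y := Im z).
  assert (Da : forall s, is_derive a s (x * a s - y * b s)%R).
  { intros s. apply (is_derive_Re _ _ _ (Cis_derive_line E z _ s (D _))). }
  assert (Db : forall s, is_derive b s (x * b s + y * a s)%R).
  { intros s. apply (is_derive_Im _ _ _ (Cis_derive_line E z _ s (D _))). }
  assert (E0 : E 0 = 1).
  { rewrite (is_psum_at_0 1 _ _ Rlt_0_1 (P 1%R)). unfold exp_coef. simpl. now rewrite Rinv_1. }
  change (E z = cexp z). clearbody E.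
  (* [K1] and [K2] are the real and imaginary parts of E(0) = e^(-z) E(z); the linear system [Da],
     [Db] makes both expressions constant in s on [0, 1]. *)
  assert (K1 : (1 * a 0 = exp (- (1 * x)) * (a 1 * cos (1 * y) + b 1 * sin (1 * y)))%R).
  { assert (Q := eq_is_derive (V := R_NormedModule)
      (fun s => exp (- (s * x)) * (a s * cos (s * y) + b s * sin (s * y)))%R 0 1).
    simpl in Q. rewrite <- Q; [|intros s _|lra].
    - rewrite !Rmult_0_l, Ropp_0, exp_0, cos_0, sin_0. ring.
    - auto_derive.
      + repeat split; eexists; [apply Da|apply Db].
      + change (fun x : R => a x) with a. change (fun x : R => b x) with b.
        rewrite (is_derive_unique _ _ _ (Da s)), (is_derive_unique _ _ _ (Db s)).
        change (@zero R_NormedModule) with 0%R. ring. }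
  assert (K2 : (1 * b 0 = exp (- (1 * x)) * (b 1 * cos (1 * y) - a 1 * sin (1 * y)))%R).
  { assert (Q := eq_is_derive (V := R_NormedModule)
      (fun s => exp (- (s * x)) * (b s * cos (s * y) - a s * sin (s * y)))%R 0 1).
    simpl in Q. rewrite <- Q; [|intros s _|lra].
    - rewrite !Rmult_0_l, Ropp_0, exp_0, cos_0, sin_0. ring.
    - auto_derive.
      + repeat split; eexists; [apply Db|apply Da].
      + change (fun x : R => a x) with a. change (fun x : R => b x) with b.
        rewrite (is_derive_unique _ _ _ (Da s)), (is_derive_unique _ _ _ (Db s)).
        change (@zero R_NormedModule) with 0%R. ring. }
  unfold a, b in K1, K2. rewrite Cmult_0_l, Cmult_1_l, E0 in K1, K2.
  rewrite !Rmult_1_l in K1, K2. unfold Re, Im in K1, K2. simpl fst in K1 at 1. simpl snd in K2 at 1.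
  (* [K1] and [K2] are solved for E(z): multiply by exp x and undo the rotation by y. *)
  assert (X : (exp x * exp (- x) = 1)%R) by (rewrite <- exp_plus, Rplus_opp_r; apply exp_0).
  assert (T := sin2_cos2 y). unfold Rsqr in T.
  unfold cexp. fold x y.
  apply injective_projections; simpl.
  - transitivity (exp x * cos y)%R; [|ring].
    transitivity ((exp x * exp (- x)) * (sin y * sin y + cos y * cos y) * fst (E z))%R.
    { rewrite X, T. ring. }
    transitivity (exp x * (cos y * (exp (- x) * (fst (E z) * cos y + snd (E z) * sin y))
      - sin y * (exp (- x) * (snd (E z) * cos y - fst (E z) * sin y))))%R; [ring|].
    rewrite <- K1, <- K2. ring.
  - transitivity (exp x * sin y)%R; [|ring].
    transitivity ((exp x * exp (- x)) * (sin y * sin y + cos y * cos y) * snd (E z))%R.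
    { rewrite X, T. ring. }
    transitivity (exp x * (sin y * (exp (- x) * (fst (E z) * cos y + snd (E z) * sin y))
      + cos y * (exp (- x) * (snd (E z) * cos y - fst (E z) * sin y))))%R; [ring|].
    rewrite <- K1, <- K2. ring.
Qed.

Lemma Cis_derive_cexp (t : C) : Cis_derive cexp t (cexp t).
Proof.
  assert (P := is_psum_cexp (Cmod t + 1)).
  replace (cexp t) with (CSeries (fun n => Cderive_coef exp_coef n * t ^ n)).
  - apply is_psum_derive_at with (Cmod t + 1)%R; [exact P|lra].
  - apply CSeries_unique. apply is_series_ext with (fun n => exp_coef n * t ^ n).
    + intros n. now rewrite Cderive_exp_coef.
    + apply P. lra.
Qed.

Lemma cexp_0 : cexp 0 = 1.
Proof.
  rewrite (is_psum_at_0 1 _ _ Rlt_0_1 (is_psum_cexp 1)).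
  unfold exp_coef. simpl. now rewrite Rinv_1.
Qed.

Lemma cexp_plus (a b : C) : cexp (a + b) = cexp a * cexp b.
Proof.
  unfold cexp. destruct a as [a1 a2], b as [b1 b2]. simpl.
  rewrite exp_plus, cos_plus, sin_plus.
  apply injective_projections; simpl; ring.
Qed.

Lemma cexp_INR_mult (p : nat) (t : C) : cexp (RtoC (INR p) * t) = cexp t ^ p.
Proof.
  induction p as [|p IH].
  - simpl. rewrite Cmult_0_l. apply cexp_0.
  - rewrite S_INR, RtoC_plus, Cmult_plus_distr_r, cexp_plus, IH, Cmult_1_l. simpl. ring.
Qed.

Lemma cexp_neq_0 (t : C) : cexp t <> 0.
Proof.
  intros H. apply C1_nz. rewrite <- cexp_0.
  replace (RtoC 0) with (t + - t) by ring. rewrite cexp_plus, H. ring.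
Qed.

(** * The hypergeometric series *)

(** The coefficient (1)_m (1)_m / ((p+2)_m m!), which is the reciprocal of the binomial coefficient
    of p + 1 + m over m. *)
Definition hyp_coef (p m : nat) : R :=
  (INR (fact m) * INR (fact (p + 1)) / INR (fact (p + 1 + m)))%R.

Lemma hyp_coef_0 (p : nat) : hyp_coef p 0 = 1%R.
Proof.
  unfold hyp_coef. rewrite Nat.add_0_r. simpl fact at 1. rewrite INR_1.
  field. apply INR_fact_neq_0.
Qed.

Lemma hyp_coef_S (p m : nat) :
  (hyp_coef p (S m) = hyp_coef p m * ((INR m + 1) / (INR p + INR m + 2)))%R.
Proof.
  unfold hyp_coef. replace (p + 1 + S m)%nat with (S (p + 1 + m)) by lia.
  rewrite 2!fact_simpl, !mult_INR, !S_INR, !plus_INR. simpl (INR 1).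
  assert (Hp := pos_INR p). assert (Hm := pos_INR m).
  field. repeat split; try apply INR_fact_neq_0; lra.
Qed.

Lemma hyp_coef_bound (p m : nat) : (0 <= hyp_coef p m <= 1)%R.
Proof.
  induction m as [|m IH].
  - rewrite hyp_coef_0. lra.
  - rewrite hyp_coef_S. assert (Hp := pos_INR p). assert (Hm := pos_INR m).
    assert (B : (0 <= (INR m + 1) / (INR p + INR m + 2) <= 1)%R).
    { split; [apply Rdiv_le_0_compat; lra|]. apply Rle_div_l; lra. }
    nra.
Qed.

Lemma rising_1 (m : nat) : rising 1 m = RtoC (INR (fact m)).
Proof.
  induction m as [|m IH]; [easy|]. simpl rising.
  rewrite IH, fact_simpl, mult_INR, S_INR, RtoC_mult, RtoC_plus. ring.
Qed.

Lemma rising_INR (p m : nat) :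
  rising (RtoC (INR p) + 2) m
  = RtoC (INR (fact (p + 1 + m)) / INR (fact (p + 1))).
Proof.
  induction m as [|m IH].
  - rewrite Nat.add_0_r. unfold Rdiv. rewrite Rinv_r by apply INR_fact_neq_0. easy.
  - simpl rising. rewrite IH. replace (p + 1 + S m)%nat with (S (p + 1 + m)) by lia.
    rewrite fact_simpl, mult_INR, S_INR, !plus_INR. simpl (INR 1).
    rewrite <- !RtoC_plus, <- RtoC_mult. f_equal. field. apply INR_fact_neq_0.
Qed.

Lemma is_psum_hyp2F1 (p : nat) :
  is_psum 1 (fun m => RtoC (hyp_coef p m)) (hyp2F1 1 1 (RtoC (INR p) + 2)).
Proof.
  assert (H := is_psum_CSeries 1 (fun m => RtoC (hyp_coef p m))).
  assert (B : forall m, (Cmod (RtoC (hyp_coef p m)) <= 1)%R).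
  { intros m. assert (B := hyp_coef_bound p m). rewrite Cmod_R, Rabs_right; lra. }
  specialize (H (ex_series_bounded_coef _ B)).
  apply is_psum_ext with (3 := H); [easy|]. intros z Hz.
  unfold hyp2F1. symmetry. apply CSeries_unique.
  apply is_series_ext with (2 := proj2 H z Hz). intros m.
  rewrite rising_1, rising_INR. unfold hyp_coef. as_complex_eq.
  assert (F := INR_fact_neq_0). unfold Rdiv.
  rewrite !RtoC_mult, !RtoC_inv
    by (try apply Rmult_integral_contrapositive_currified;
        try apply Rinv_neq_0_compat; apply F).
  field. repeat split; intros K; apply RtoC_inj in K; revert K; apply F.
Qed.

Lemma RtoC_INR_S_neq_0 (n : nat) : RtoC (INR n) + 1 <> 0.
Proof.
  rewrite <- RtoC_plus. intros K. apply RtoC_inj in K.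
  generalize (pos_INR n). lra.
Qed.

Lemma hyp2F1_0 (p : nat) : hyp2F1 1 1 (RtoC (INR p) + 2) 0 = 1.
Proof. rewrite (is_psum_at_0 1 _ _ Rlt_0_1 (is_psum_hyp2F1 p)). now rewrite hyp_coef_0. Qed.

(** With c_(q,m) for [hyp_coef q m], the coefficient identity is (q+1) c_(q+1,m) = (q+2) (c_(q,m) -
    c_(q,m+1)). The shifted coefficients sum to g with z g = h_q - 1, so multiplication by z gives
    the claim. *)
Lemma hyp2F1_contiguous (q : nat) (z : C) : (Cmod z < 1)%R ->
  (RtoC (INR q) + 1) * z * hyp2F1 1 1 (RtoC (INR (S q)) + 2) z
  = (RtoC (INR q) + 2) * ((z - 1) * hyp2F1 1 1 (RtoC (INR q) + 2) z + 1).
Proof.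
  intros Hz.
  destruct (is_psum_shift 1 _ _ (is_psum_hyp2F1 q)) as [g [Hg Eg]].
  set (h := hyp2F1 1 1 (RtoC (INR q) + 2)) in *.
  specialize (Eg z Hz). rewrite hyp_coef_0 in Eg.
  assert (K : (RtoC (INR q) + 1) * hyp2F1 1 1 (RtoC (INR (S q)) + 2) z
              = (RtoC (INR q) + 2) * (h z - g z)).
  { assert (S1 := is_series_scal (RtoC (INR q) + 1) _ _ (proj2 (is_psum_hyp2F1 (S q)) z Hz)).
    assert (S2 := is_series_scal (RtoC (INR q) + 2) _ _
       (is_series_minus _ _ _ _ (proj2 (is_psum_hyp2F1 q) z Hz) (proj2 Hg z Hz))).
    apply Cis_series_unique with (1 := S1).
    apply is_series_ext with (2 := S2). intros m.
    change ((RtoC (INR q) + 2) * (RtoC (hyp_coef q m) * z ^ m - RtoC (hyp_coef q (S m)) * z ^ m)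
      = (RtoC (INR q) + 1) * (RtoC (hyp_coef (S q) m) * z ^ m)).
    transitivity (RtoC ((INR q + 2) * (hyp_coef q m - hyp_coef q (S m))) * z ^ m).
    { rewrite RtoC_mult, RtoC_minus, RtoC_plus. ring. }
    transitivity (RtoC ((INR q + 1) * hyp_coef (S q) m) * z ^ m).
    2:{ rewrite RtoC_mult, RtoC_plus. ring. }
    do 2 f_equal. rewrite hyp_coef_S. unfold hyp_coef.
    replace (S q + 1 + m)%nat with (S (q + 1 + m)) by lia.
    replace (S q + 1)%nat with (S (q + 1)) by lia.
    rewrite 2!(fact_simpl (_ + _)), !mult_INR, !S_INR, !plus_INR. simpl (INR 1).
    assert (Hp := pos_INR q). assert (Hm := pos_INR m).
    field. repeat split; try apply INR_fact_neq_0; lra. }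
  replace ((RtoC (INR q) + 1) * z * hyp2F1 1 1 (RtoC (INR (S q)) + 2) z)
    with (z * ((RtoC (INR q) + 1) * hyp2F1 1 1 (RtoC (INR (S q)) + 2) z)) by ring.
  rewrite K. replace (z * ((RtoC (INR q) + 2) * (h z - g z)))
    with ((RtoC (INR q) + 2) * (z * h z - z * g z)) by ring.
  replace (z * g z) with (h z - 1) by (rewrite Eg; ring). ring.
Qed.

(** A shift leaves the constant sequence unchanged, so the sum s satisfies s = 1 + z s. *)
Lemma Cgeometric (z : C) : (Cmod z < 1)%R ->
  z <> 1 /\ CSeries (fun n => 1 * z ^ n) = / (1 - z).
Proof.
  intros Hz.
  assert (Hz1 : z <> 1). { intros ->. rewrite Cmod_1 in Hz. lra. }
  split; [easy|].
  assert (P : is_psum 1 (fun _ => RtoC 1) (fun z => CSeries (fun n => 1 * z ^ n))).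
  { apply is_psum_CSeries, ex_series_bounded_coef. intros _. rewrite Cmod_1. lra. }
  destruct (is_psum_shift 1 _ _ P) as [g [Hg Eg]]. specialize (Eg z Hz).
  assert (K : g z = CSeries (fun n => 1 * z ^ n)).
  { apply Cis_series_unique with (1 := proj2 Hg z Hz). apply (proj2 P), Hz. }
  rewrite K in Eg. set (s := CSeries _) in *.
  assert (N : 1 - z <> 0).
  { intros N. apply Hz1. replace z with (1 - (1 - z)) by ring. rewrite N. ring. }
  replace s with ((s - z * s) / (1 - z)) by (field; exact N).
  replace (s - z * s) with (RtoC 1) by (rewrite Eg at 1; ring). field; exact N.
Qed.

(* The function [z * 2F1(1,1;2;z)] has derivative [1 / (1 - z)], so composing it with
   [1 - e^t] gives derivative [-1]. *)
Lemma hyp2F1_log (r : R) : (forall t, (Cmod t < r)%R -> (Cmod (1 - cexp t) < 1)%R) ->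
  forall t, (Cmod t < r)%R ->
  (1 - cexp t) * hyp2F1 1 1 (RtoC (INR 0) + 2) (1 - cexp t) = - t.
Proof.
  intros Hr t Ht.
  set (h := hyp2F1 1 1 (RtoC (INR 0) + 2)).
  set (f := fun z => z * h z).
  assert (Df : forall z, (Cmod z < 1)%R -> Cis_derive f z (/ (1 - z))).
  { intros z Hz. destruct (Cgeometric z Hz) as [_ <-].
    (* The coefficients 0, 1, 1/2, 1/3, ... of z h_0(z), that is of -log(1 - z); their formal
       derivative is the geometric series. *)
    set (l := fun n => match n with O => RtoC 0 | S m => RtoC (hyp_coef 0 m) end).
    assert (P := is_psum_hyp2F1 0). fold h in P.
    assert (El : forall n, Cderive_coef l n = 1).
    { intros n. unfold Cderive_coef, l, hyp_coef. rewrite <- RtoC_mult. f_equal.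
      replace (0 + 1 + n)%nat with (S n) by lia. rewrite (fact_simpl n), mult_INR.
      simpl (fact (0 + 1)). rewrite INR_1. field.
      split; [apply INR_fact_neq_0|]. apply not_0_INR. lia. }
    assert (Bl : forall n, (Cmod (l n) <= 1)%R).
    { intros [|n]; unfold l.
      - rewrite Cmod_0. lra.
      - assert (B := hyp_coef_bound 0 n). rewrite Cmod_R, Rabs_right; lra. }
    assert (Pl : is_psum 1 l f).
    { apply is_psum_ext with (3 := is_psum_CSeries 1 l (ex_series_bounded_coef l Bl)); [easy|].
      intros s Hs. apply CSeries_unique. apply is_series_decr_1.
      assert (K := is_series_scal s _ _ (proj2 P s Hs)).
      match type of K with is_series _ ?x =>
        match goal with |- is_series _ ?y => replace y with x end end.
      2:{ change (s * h s = s * h s + - (0 * 1)). ring. }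
      apply is_series_ext with (2 := K). intros n.
      change (s * (RtoC (hyp_coef 0 n) * s ^ n) = RtoC (hyp_coef 0 n) * (s * s ^ n)). ring. }
    assert (D := is_psum_derive_at 1 l f z Pl Hz).
    replace (CSeries (fun n => 1 * z ^ n))
      with (CSeries (fun n => Cderive_coef l n * z ^ n)); [exact D|].
    apply CSeries_unique.
    apply is_series_ext with (fun n => 1 * z ^ n).
    { intros n. now rewrite El. }
    apply CSeries_correct, ex_series_Cmod_term.
    apply (ex_series_bounded_coef (fun _ => RtoC 1)).
    - intros _. rewrite Cmod_1. lra.
    - split; [apply Cmod_ge_0|easy]. }
  assert (D : forall s, (Cmod s < r)%R -> Cis_derive (fun s => f (1 - cexp s) + s) s 0).
  { intros s Hs.
    assert (De : Cis_derive (fun s => 1 - cexp s) s (0 - cexp s)).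
    { exact (is_derive_minus _ _ _ _ _ (is_derive_const _ _) (Cis_derive_cexp s)). }
    assert (D1 := Cis_derive_comp f _ s _ _ (Df _ (Hr s Hs)) De).
    assert (D2 : Cis_derive (fun s => s) s 1).
    { apply Cis_derive_AbsRing. exact (is_derive_id (K := C_AbsRing) s). }
    replace (RtoC 0) with ((0 - cexp s) * / (1 - (1 - cexp s)) + 1).
    - exact (is_derive_plus _ _ _ _ _ D1 D2).
    - field. intros K. apply (cexp_neq_0 s). cbv beta in K. rewrite <- K. ring. }
  assert (K := Cderive_zero_constant _ r D t Ht). simpl in K.
  rewrite cexp_0 in K. unfold f in K at 2.
  replace ((1 - 1) * h (1 - 1) + 0) with (RtoC 0) in K by ring.
  change (f (1 - cexp t) = - t).
  replace (f (1 - cexp t)) with (f (1 - cexp t) + t - t) by ring. rewrite K. ring.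
Qed.

(** * Expansion in powers of [t] *)

(* Coefficients [b n, ..., b 0] of the reciprocal of the power series [e],
   in decreasing order of the index. *)
Fixpoint reciprocal_list (e : nat -> C) (n : nat) : list C :=
  match n with
  | O => RtoC 1 :: nil
  | S m =>
      let l := reciprocal_list e m in
      (- sum_n (G := C_AbelianMonoid) (fun k => e (S k) * nth k l (RtoC 0)) m) :: l
  end.

Definition reciprocal (e : nat -> C) (n : nat) : C := nth 0 (reciprocal_list e n) (RtoC 0).

Lemma nth_reciprocal_list (e : nat -> C) (n k : nat) : (k <= n)%nat ->
  nth k (reciprocal_list e n) (RtoC 0) = reciprocal e (n - k).
Proof.
  revert k. induction n as [|n IH]; intros k Hk.
  - now replace k with 0%nat by lia.
  - destruct k as [|k]; [easy|]. simpl. apply IH. lia.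
Qed.

(** This is the convolution equation sum e_k b_(n+1-k) = 0 solved for b_(n+1) with e_0 = 1. It
    involves all earlier coefficients, which is why a whole list is carried. *)
Lemma reciprocal_S (e : nat -> C) (n : nat) :
  reciprocal e (S n)
  = - sum_n (G := C_AbelianMonoid) (fun k => e (S k) * reciprocal e (n - k)%nat) n.
Proof.
  unfold reciprocal at 1. simpl. f_equal.
  apply sum_n_ext_loc. intros k Hk. now rewrite nth_reciprocal_list.
Qed.

Lemma sum_n_C_S (u : nat -> C) (n : nat) :
  sum_n (G := C_AbelianMonoid) u (S n)
  = u 0%nat + sum_n (G := C_AbelianMonoid) (fun k => u (S k)) n.
Proof.
  induction n as [|n IH].
  - now rewrite sum_Sn, !sum_O.
  - rewrite sum_Sn, IH, (sum_Sn (fun k => u (S k))).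
    symmetry. apply Cplus_assoc.
Qed.

Lemma conv_reciprocal (e : nat -> C) (n : nat) : e 0%nat = 1 ->
  conv e (reciprocal e) n = match n with O => RtoC 1 | S _ => RtoC 0 end.
Proof.
  intros He. destruct n as [|n]; unfold conv.
  - rewrite sum_O, He. apply Cmult_1_l.
  - rewrite sum_n_C_S, He, Nat.sub_0_r, reciprocal_S. simpl. ring.
Qed.

(** Strong induction: if all earlier coefficients have modulus at most 1, the recursion bounds the
    next one by the sum of the |e_(k+1)|. *)
Lemma reciprocal_bound (e : nat -> C) :
  (forall n, (sum_n (fun k => Cmod (e (S k))) n <= 1)%R) ->
  forall n, (Cmod (reciprocal e n) <= 1)%R.
Proof.
  intros He n. induction n as [n IH] using (well_founded_induction Wf_nat.lt_wf).
  destruct n as [|n].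
  - unfold reciprocal. simpl. rewrite Cmod_1. lra.
  - rewrite reciprocal_S, Cmod_opp.
    eapply Rle_trans; [apply Cmod_sum_n_le|].
    eapply Rle_trans; [|apply (He n)].
    rewrite !sum_n_Reals. apply sum_Rle. intros k Hk. rewrite Cmod_mult.
    assert (B := IH (n - k)%nat ltac:(lia)). assert (P := Cmod_ge_0 (e (S k))). nra.
Qed.

(** The subtracted term makes the bound inductive: 1/(n+3)! <= 1/(n+2)! - 1/(n+3)!, because n + 3 >=
    2. *)
Lemma exp_coef_tail_sum (n : nat) :
  (sum_n (fun k => Cmod (exp_coef (S (S k)))) n <= 1 - / INR (fact (S (S n))))%R.
Proof.
  assert (E : forall k, Cmod (exp_coef k) = (/ INR (fact k))%R).
  { intros k. unfold exp_coef. rewrite Cmod_R, Rabs_right; [easy|].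
    apply Rle_ge, Rlt_le, Rinv_0_lt_compat, INR_fact_lt_0. }
  induction n as [|n IH].
  - rewrite sum_O, E. simpl. lra.
  - rewrite sum_Sn, E. eapply Rle_trans; [apply Rplus_le_compat_r, IH|].
    rewrite (fact_simpl (S (S n))), mult_INR, Rinv_mult.
    assert (F := Rinv_0_lt_compat _ (INR_fact_lt_0 (S (S n)))).
    assert (G : (/ INR (S (S (S n))) <= / 2)%R).
    { apply Rinv_le_contravar; [lra|]. rewrite !S_INR. generalize (pos_INR n). lra. }
    change (1 - / INR (fact (S (S n))) + / INR (S (S (S n))) * / INR (fact (S (S n)))
      <= 1 - / INR (S (S (S n))) * / INR (fact (S (S n))))%R.
    nra.
Qed.

(* [b] is the Taylor series of [t / (e^t - 1)]. *)
Lemma cexp_minus_1_factor :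
  exists (E B : C -> C) (b : nat -> C),
    (forall t, cexp t = 1 + t * E t) /\ is_psum 1 b B /\ B 0 = 1 /\
    (forall t, (Cmod t < 1)%R -> E t * B t = 1).
Proof.
  assert (P : forall r, is_psum r (fun n => exp_coef (S n))
                (fun t => CSeries (fun n => exp_coef (S n) * t ^ n))).
  { intros r. destruct (is_psum_shift r _ _ (is_psum_cexp r)) as [g [[Hg _] _]].
    apply is_psum_CSeries, Hg. }
  set (E := fun t => CSeries (fun n => exp_coef (S n) * t ^ n)) in *.
  set (e := fun n => exp_coef (S n)) in *.
  assert (e0 : e 0%nat = 1). { unfold e, exp_coef. simpl. now rewrite Rinv_1. }
  assert (Pb : is_psum 1 (reciprocal e) (fun t => CSeries (fun n => reciprocal e n * t ^ n))).
  { apply is_psum_CSeries, ex_series_bounded_coef, reciprocal_bound. intros n.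
    eapply Rle_trans; [apply (exp_coef_tail_sum n)|].
    generalize (Rinv_0_lt_compat _ (INR_fact_lt_0 (S (S n)))). lra. }
  exists E. eexists. exists (reciprocal e). split; [|split; [exact Pb|split]].
  - intros t. destruct (is_psum_shift (Cmod t + 1) _ _ (is_psum_cexp (Cmod t + 1))) as [g [Hg Eg]].
    rewrite Eg by lra. f_equal.
    + unfold exp_coef. simpl. now rewrite Rinv_1.
    + f_equal. symmetry. apply CSeries_unique, Hg. lra.
  - rewrite (is_psum_at_0 1 _ _ Rlt_0_1 Pb). easy.
  (* The Cauchy product has coefficients 1, 0, 0, ..., hence sum 1. *)
  - intros t Ht. assert (K := proj2 (is_psum_mult 1 _ _ _ _ (P 1%R) Pb) t Ht).
    apply Cis_series_unique with (1 := K).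
    replace (RtoC 1) with ((fun n => conv e (reciprocal e) n * t ^ n) 0%nat).
    + apply Cis_series_head. intros n. rewrite (conv_reciprocal e (S n) e0). ring.
    + rewrite (conv_reciprocal e 0 e0). simpl. ring.
Qed.

(** Differentiability at 0 with tolerance 1 gives |e^t - 1 - t| <= |t|, so |1 - e^t| <= 2 |t|, which
    is below 1 for |t| < 1/2. *)
Lemma cexp_near_1 : exists r, (0 < r <= 1)%R /\
  forall t, (Cmod t < r)%R -> (Cmod (1 - cexp t) < 1)%R.
Proof.
  destruct (Cis_derive_cexp 0) as [_ H].
  destruct (H (RtoC 0) (fun P HP => HP) (mkposreal 1 Rlt_0_1)) as [[d Hd] Hb].
  exists (Rmin d (1 / 2)). split.
  { split; [apply Rmin_pos; lra|]. eapply Rle_trans; [apply Rmin_r|]. lra. }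
  intros t Ht.
  assert (Ht1 := Rlt_le_trans _ _ _ Ht (Rmin_l _ _)).
  assert (Ht2 := Rlt_le_trans _ _ _ Ht (Rmin_r _ _)).
  assert (K : (Cmod (cexp t - cexp 0 - (t - 0) * cexp 0) <= 1 * Cmod (t - 0))%R).
  { apply Hb. change (Cmod (t - 0) < d)%R. now replace (t - 0) with t by ring. }
  rewrite cexp_0 in K. replace (t - 0) with t in K by ring.
  replace (1 - cexp t) with (- (cexp t - 1 - t * 1) + - t) by ring.
  eapply Rle_lt_trans; [apply Cmod_triangle|]. rewrite !Cmod_opp. lra.
Qed.

(** * The generating function as a power series in t *)

Lemma pBernoulli_contiguous (q : nat) (t : C) :
  (Cmod (1 - cexp t) < 1)%R ->
  (RtoC (INR q) + 1) * (cexp t - 1) * pBernoulli_fun (S q) t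
  = (RtoC (INR q) + 2) * (cexp t * pBernoulli_fun q t - 1).
Proof.
  intros H. assert (K := hyp2F1_contiguous q _ H). unfold pBernoulli_fun.
  set (u := hyp2F1 _ _ _ _) in *. set (v := hyp2F1 _ _ _ _) in *.
  replace ((RtoC (INR q) + 1) * (cexp t - 1) * u)
    with (- ((RtoC (INR q) + 1) * (1 - cexp t) * u)) by ring.
  rewrite K. ring.
Qed.

Lemma pBernoulli_fun_0 (p : nat) : pBernoulli_fun p 0 = 1.
Proof.
  unfold pBernoulli_fun. rewrite cexp_0. replace (1 - 1) with (RtoC 0) by ring.
  apply hyp2F1_0.
Qed.

(** Chain rule with h_p'(0) = 1/(p+2). It supplies the first Taylor coefficient of e^t h_p(1 - e^t),
    from which the value of the next function at 0 is checked. *)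
Lemma Cis_derive_pBernoulli_fun_0 (p : nat) :
  Cis_derive (pBernoulli_fun p) 0 (- RtoC (/ (INR p + 2))).
Proof.
  assert (D1 := is_psum_derive_at 1 _ _ 0 (is_psum_hyp2F1 p) ltac:(rewrite Cmod_0; lra)).
  assert (Pd := is_psum_CSeries 1 _ (ex_series_Cderive_coef _ 1 (proj1 (is_psum_hyp2F1 p)))).
  assert (E := is_psum_at_0 1 _ _ Rlt_0_1 Pd). cbv beta in E. rewrite E in D1.
  assert (De : Cis_derive (fun s => 1 - cexp s) 0 (0 - cexp 0)).
  { exact (is_derive_minus _ _ _ _ _ (is_derive_const _ _) (Cis_derive_cexp 0)). }
  replace (RtoC 0) with (1 - cexp 0) in D1 by (rewrite cexp_0; ring).
  assert (D := Cis_derive_comp _ (fun s => 1 - cexp s) 0 _ _ D1 De).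
  replace (- RtoC (/ (INR p + 2)))
    with ((0 - cexp 0) * Cderive_coef (fun m => RtoC (hyp_coef p m)) 0); [exact D|].
  unfold Cderive_coef. rewrite cexp_0, hyp_coef_S, hyp_coef_0, <- RtoC_mult.
  rewrite <- RtoC_minus, <- RtoC_mult, <- RtoC_opp. f_equal. simpl.
  generalize (pos_INR p). intros Hp. field. lra.
Qed.

(** The induction step is h_(q+1) = k N B with N = (e^t h_q - 1) / t, B = t / (e^t - 1) and k =
    (q+2)/(q+1). *)
Lemma is_psum_pBernoulli_fun (r : R) : (0 < r <= 1)%R ->
  (forall t, (Cmod t < r)%R -> (Cmod (1 - cexp t) < 1)%R) ->
  forall p, exists a, is_psum r a (pBernoulli_fun p).
Proof.
  intros Hr Hexp p.
  destruct cexp_minus_1_factor as [E [B [b [HE [HB [B0 HEB]]]]]].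
  apply (is_psum_le 1 r) in HB; [|lra].
  assert (EB : forall t, (Cmod t < r)%R -> E t * B t = 1) by (intros; apply HEB; lra).
  induction p as [|q [a IH]].
  - exists b. apply is_psum_ext with (3 := HB); [easy|]. intros t Ht.
    destruct (Ceq_dec t 0) as [->|Ht0].
    { now rewrite pBernoulli_fun_0. }
    assert (K := hyp2F1_log r Hexp t Ht). fold (pBernoulli_fun 0 t) in K.
    rewrite HE in K.
    assert (K2 : E t * pBernoulli_fun 0 t = 1).
    { replace (E t * pBernoulli_fun 0 t)
        with (((1 - (1 + t * E t)) * pBernoulli_fun 0 t) / (- t)).
      - rewrite K. field. exact Ht0.
      - field. exact Ht0. }
    transitivity (E t * pBernoulli_fun 0 t * B t); [rewrite K2; ring|].
    transitivity (E t * B t * pBernoulli_fun 0 t); [ring|].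
    rewrite EB by easy. ring.
  - assert (P := is_psum_mult r _ _ _ _ (is_psum_cexp r) IH).
    destruct (is_psum_shift r _ _ P) as [N [HN EN]].
    set (c := conv exp_coef a) in *. cbv beta in EN.
    assert (c0 : c 0%nat = 1).
    { rewrite <- (is_psum_at_0 r c _ ltac:(lra) P), cexp_0, pBernoulli_fun_0. ring. }
    set (k := RtoC ((INR q + 2) / (INR q + 1))).
    assert (Hq := pos_INR q).
    (* N(0) is the derivative of e^t h_q at 0, namely 1 - 1/(q+2). It is the reciprocal of k, so the
       product takes the required value 1 at t = 0. *)
    assert (N0 : N 0 = RtoC ((INR q + 1) / (INR q + 2))).
    { rewrite (is_psum_at_0 r _ _ ltac:(lra) HN).
      assert (D := is_psum_at_0 r _ _ ltac:(lra) (is_psum_C_derive r _ _ P)).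
      rewrite (Cis_derive_C_derive _ _ _
        (Cis_derive_mult _ _ _ _ _ (Cis_derive_cexp 0) (Cis_derive_pBernoulli_fun_0 q))) in D.
      unfold Cderive_coef in D. rewrite INR_1, Cmult_1_l, cexp_0, pBernoulli_fun_0 in D.
      rewrite <- D.
      transitivity (RtoC (1 - / (INR q + 2))).
      - rewrite RtoC_minus. ring.
      - f_equal. field. lra. }
    eexists. apply is_psum_ext with (3 := is_psum_scal r k _ _ (is_psum_mult r _ _ _ _ HN HB)).
    { intros n. reflexivity. }
    intros t Ht. destruct (Ceq_dec t 0) as [->|Ht0].
    { rewrite pBernoulli_fun_0, N0, B0. unfold k. rewrite Cmult_1_r, <- RtoC_mult. f_equal.
      field. lra. }
    assert (K := pBernoulli_contiguous q t (Hexp t Ht)).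
    rewrite EN, c0 in K by easy. rewrite HE in K.
    assert (Q1 : RtoC (INR q) + 1 <> 0) by apply RtoC_INR_S_neq_0.
    assert (K2 : E t * pBernoulli_fun (S q) t = k * N t).
    { transitivity (((RtoC (INR q) + 1) * (1 + t * E t - 1) * pBernoulli_fun (S q) t)
         / ((RtoC (INR q) + 1) * t)).
      - field. now split.
      - rewrite K. unfold k. rewrite RtoC_div, !RtoC_plus by lra. field. now split. }
    transitivity (E t * pBernoulli_fun (S q) t * B t); [rewrite K2; ring|].
    transitivity (E t * B t * pBernoulli_fun (S q) t); [ring|].
    rewrite EB by easy. ring.
Qed.

(** Since e^t - 1 = t E(t), a zero with t <> 0 would force E(t) = 0, against E B = 1. *)
Lemma cexp_neq_1 (t : C) : (0 < Cmod t < 1)%R -> cexp t - 1 <> 0.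
Proof.
  intros Ht H. destruct cexp_minus_1_factor as [E [B [b [HE [_ [_ HEB]]]]]].
  assert (K := HEB t ltac:(lra)). rewrite HE in H.
  assert (Ht0 : t <> 0) by now apply Cmod_gt_0.
  apply C1_nz. rewrite <- K.
  replace (E t) with ((1 + t * E t - 1) / t) by (field; easy). rewrite H. field. easy.
Qed.

(** * The closed form *)

Definition binomial_transform (x : nat -> C) (n : nat) : C :=
  sum_n (G := C_AbelianMonoid) (fun k => RtoC (Binomial.C n k) * x k) n.

Lemma binomial_n_0 (n : nat) : Binomial.C n 0 = 1%R.
Proof. unfold Binomial.C. rewrite Nat.sub_0_r. simpl. field. apply INR_fact_neq_0. Qed.

Lemma binomial_n_n (n : nat) : Binomial.C n n = 1%R.
Proof. unfold Binomial.C. rewrite Nat.sub_diag. simpl. field. apply INR_fact_neq_0. Qed.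

Lemma sum_n_C_plus (u v : nat -> C) (n : nat) :
  sum_n (G := C_AbelianMonoid) (fun k => u k + v k) n
  = sum_n (G := C_AbelianMonoid) u n + sum_n (G := C_AbelianMonoid) v n.
Proof. exact (sum_n_plus (G := C_AbelianMonoid) u v n). Qed.

Lemma sum_n_C_mult_l (c : C) (u : nat -> C) (n : nat) :
  sum_n (G := C_AbelianMonoid) (fun k => c * u k) n
  = c * sum_n (G := C_AbelianMonoid) u n.
Proof. exact (sum_n_mult_l (K := C_Ring) c u n). Qed.

(** Pascal's rule on the inner terms. Both end terms are split off: with truncated subtraction
    [Binomial.C n (S n)] is 1/(n+1) rather than 0. *)
Lemma binomial_transform_S (x : nat -> C) (n : nat) :
  binomial_transform x (S n)
  = binomial_transform x n + binomial_transform (fun k => x (S k)) n.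
Proof.
  unfold binomial_transform. rewrite sum_n_C_S, binomial_n_0.
  destruct n as [|m].
  - rewrite !sum_O, !binomial_n_n. ring.
  - rewrite (sum_n_C_S (fun k => RtoC (Binomial.C (S m) k) * x k)), binomial_n_0.
    rewrite !sum_Sn, !binomial_n_n.
    rewrite (sum_n_ext_loc _ (fun k => RtoC (Binomial.C (S m) (S k)) * x (S k)
                                + RtoC (Binomial.C (S m) k) * x (S k)) m).
    2:{ intros k Hk. rewrite <- pascal by lia. rewrite RtoC_plus. as_complex_eq. ring. }
    rewrite sum_n_C_plus.
    match goal with |- _ + plus (?u + ?v) ?w = _ => change (plus (u + v) w) with (u + v + w) end.
    match goal with |- _ = _ + plus ?u ?w => change (plus u w) with (u + w) end.
    ring.
Qed.

Lemma binomial_transform_linear (x y : nat -> C) (c d : C) (n : nat) :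
  binomial_transform (fun k => c * x k + d * y k) n
  = c * binomial_transform x n + d * binomial_transform y n.
Proof.
  unfold binomial_transform. rewrite <- !sum_n_C_mult_l, <- sum_n_C_plus.
  apply sum_n_ext. intros k. as_complex_eq. ring.
Qed.

Lemma binomial_transform_pow (u : C) (n : nat) :
  binomial_transform (fun k => u ^ k) n = (1 + u) ^ n.
Proof.
  induction n as [|n IH].
  - unfold binomial_transform. rewrite sum_O, binomial_n_0. simpl. ring.
  - rewrite binomial_transform_S, IH.
    replace (binomial_transform (fun k => u ^ S k) n) with (u * (1 + u) ^ n).
    + simpl. ring.
    + rewrite <- IH. unfold binomial_transform. rewrite <- sum_n_C_mult_l.
      apply sum_n_ext. intros k. as_complex_eq. simpl. ring.
Qed.

(** Since (n+1) C(n,k) / (k+1) = C(n+1,k+1), this is the binomial theorem for n + 1 without its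
    constant term. *)
Lemma binomial_transform_pow_div (u : C) (n : nat) :
  (RtoC (INR n) + 1) * binomial_transform (fun k => u ^ S k * RtoC (/ INR (S k))) n
  = (1 + u) ^ S n - 1.
Proof.
  rewrite <- (binomial_transform_pow u (S n)). unfold binomial_transform.
  rewrite sum_n_C_S, binomial_n_0, <- sum_n_C_mult_l. simpl (u ^ 0).
  assert (A : forall l r : C, l = r -> l = RtoC 1 * 1 + r - 1) by (intros; subst; ring).
  apply A. clear A.
  apply sum_n_ext_loc. intros k Hk. as_complex_eq.
  transitivity (RtoC ((INR n + 1) * Binomial.C n k * / INR (S k)) * u ^ S k).
  { rewrite !RtoC_mult, RtoC_plus. ring. }
  do 2 f_equal. unfold Binomial.C. replace (S n - S k)%nat with (n - k)%nat by lia.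
  rewrite !fact_simpl, !mult_INR, (S_INR n). field.
  repeat split; try apply INR_fact_neq_0. apply not_0_INR. lia.
Qed.

Lemma harmonic_S (n : nat) : harmonic (S n) = (harmonic n + / INR (S n))%R.
Proof. unfold harmonic. rewrite sum_n_Sm by lia. reflexivity. Qed.

Lemma harmonic_0 : harmonic 0 = 0%R.
Proof. unfold harmonic. now rewrite sum_n_m_zero by lia. Qed.

Definition harmonic_poly (u : C) (n : nat) : C :=
  binomial_transform (fun k => RtoC (harmonic k) * u ^ k) n.

(** Pascal's rule produces a shifted transform, which H_(k+1) = H_k + 1/(k+1) splits into u times
    the old one and the sum of [binomial_transform_pow_div]. *)
Lemma harmonic_poly_S (u : C) (n : nat) :
  (RtoC (INR n) + 1) * harmonic_poly u (S n)
  = (RtoC (INR n) + 1) * (1 + u) * harmonic_poly u n + ((1 + u) ^ S n - 1).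
Proof.
  unfold harmonic_poly. rewrite <- binomial_transform_pow_div, binomial_transform_S.
  set (x := fun k => RtoC (harmonic k) * u ^ k).
  replace (binomial_transform (fun k => RtoC (harmonic (S k)) * u ^ S k) n)
    with (u * binomial_transform x n
          + 1 * binomial_transform (fun k => u ^ S k * RtoC (/ INR (S k))) n).
  - ring.
  - rewrite <- binomial_transform_linear. apply sum_n_ext. intros k. as_complex_eq.
    unfold x. rewrite harmonic_S, RtoC_plus. simpl (u ^ S k). ring.
Qed.

Definition pBernoulli_closed (p : nat) (t : C) : C :=
  (RtoC (INR p) + 1) * (t - RtoC (harmonic p)) * cexp (RtoC (INR p) * t)
    / (cexp t - 1) ^ (p + 1)
  + (RtoC (INR p) + 1)
    * sum_n_m (G := C_AbelianMonoid)
        (fun k : nat => RtoC (Binomial.C p k)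
                        * (RtoC (harmonic k) / (cexp t - 1) ^ (k + 1)))
        1 p.

(** With w = e^t - 1 and u = 1/w one has e^t / w = 1 + u, so both parts become polynomials in u. As
    H_0 = 0, the sum may start at k = 0. *)
Lemma pBernoulli_closed_eq (p : nat) (t : C) : cexp t - 1 <> 0 ->
  (cexp t - 1) * pBernoulli_closed p t
  = (RtoC (INR p) + 1)
    * ((t - RtoC (harmonic p)) * (1 + / (cexp t - 1)) ^ p
       + harmonic_poly (/ (cexp t - 1)) p).
Proof.
  intros Hw. unfold pBernoulli_closed. set (w := cexp t - 1) in *.
  assert (Hs : sum_n_m (G := C_AbelianMonoid)
      (fun k => RtoC (Binomial.C p k) * (RtoC (harmonic k) / w ^ (k + 1))) 1 p
    = / w * harmonic_poly (/ w) p).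
  { unfold harmonic_poly, binomial_transform. rewrite <- sum_n_C_mult_l.
    unfold sum_n. rewrite (sum_Sn_m _ 0) by lia.
    rewrite harmonic_0.
    match goal with |- _ = plus ?x ?y => replace x with (RtoC 0) by (as_complex_eq; ring) end.
    match goal with |- ?z = plus _ ?y => change (z = 0 + y) end.
    rewrite Cplus_0_l. apply sum_n_m_ext. intros k. as_complex_eq.
    rewrite Cpow_inv, Cpow_add_r by easy. simpl (w ^ 1). field.
    split; [now apply Cpow_nz|easy]. }
  rewrite Hs, cexp_INR_mult.
  replace (1 + / w) with (cexp t * / w) by (unfold w; field; exact Hw).
  rewrite Cpow_mult_l, Cpow_inv, Cpow_add_r by easy. simpl (w ^ 1).
  field. split; [now apply Cpow_nz|easy].
Qed.

Lemma pBernoulli_fun_closed (r : R) : (0 < r <= 1)%R ->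
  (forall t, (Cmod t < r)%R -> (Cmod (1 - cexp t) < 1)%R) ->
  forall p t, (0 < Cmod t < r)%R -> pBernoulli_fun p t = pBernoulli_closed p t.
Proof.
  intros Hr Hexp p t Ht.
  assert (Hw : cexp t - 1 <> 0) by (apply cexp_neq_1; lra).
  assert (cancel : forall x y, (cexp t - 1) * x = (cexp t - 1) * y -> x = y).
  { intros x y H. replace x with ((cexp t - 1) * x / (cexp t - 1)) by (field; easy).
    rewrite H. field; easy. }
  apply cancel.
  induction p as [|q IH].
  - rewrite pBernoulli_closed_eq by easy. unfold harmonic_poly, binomial_transform.
    rewrite sum_O, harmonic_0, binomial_n_0.
    assert (K := hyp2F1_log r Hexp t (proj2 Ht)). fold (pBernoulli_fun 0 t) in K.
    transitivity (- ((1 - cexp t) * pBernoulli_fun 0 t)); [ring|]. rewrite K. simpl. ring.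
  - apply cancel in IH.
    assert (K := pBernoulli_contiguous q t (Hexp t (proj2 Ht))). rewrite IH in K.
    assert (Q1 := RtoC_INR_S_neq_0 q).
    transitivity ((RtoC (INR q) + 2) * (cexp t * pBernoulli_closed q t - 1) / (RtoC (INR q) + 1)).
    { rewrite <- K. field. easy. }
    rewrite pBernoulli_closed_eq by easy.
    assert (C := pBernoulli_closed_eq q t Hw).
    set (w := cexp t - 1) in *. set (u := / w) in *.
    replace (cexp t * pBernoulli_closed q t) with ((1 + u) * (w * pBernoulli_closed q t))
      by (unfold u, w; field; exact Hw).
    rewrite C.
    (* The increment 1/(q+1) of the harmonic number, times (1 + u)^(q+1), cancels the power in the
       inhomogeneous term here; what remains is the -1 of the contiguous relation, divided by q +
       1. *)
    assert (R := harmonic_poly_S u q).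
    rewrite S_INR, RtoC_plus, harmonic_S, RtoC_plus, RtoC_inv, S_INR, RtoC_plus
      by (apply not_0_INR; lia).
    replace (harmonic_poly u (S q)) with
      (((RtoC (INR q) + 1) * harmonic_poly u (S q)) / (RtoC (INR q) + 1)) by (field; easy).
    rewrite R. simpl ((1 + u) ^ S q). field. easy.
Qed.

Theorem theorem1p1 (p : nat) :
  let egf_term (t : C) (n : nat) : C :=
    pBernoulli n p * (t ^ n / RtoC (INR (fact n))) in
  let rhs (t : C) : C :=
    (RtoC (INR p) + 1) * (t - RtoC (harmonic p)) * cexp (RtoC (INR p) * t)
      / (cexp t - 1) ^ (p + 1)
    + (RtoC (INR p) + 1)
      * sum_n_m (G := C_AbelianMonoid)
          (fun k : nat => RtoC (Binomial.C p k)
                          * (RtoC (harmonic k) / (cexp t - 1) ^ (k + 1)))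
          1 p in
  exists r : R, (0 < r)%R /\
    (forall t : C, (Cmod t < r)%R ->
       is_series (V := C_NormedModule) (egf_term t)
         (hyp2F1 1 1 (RtoC (INR p) + 2) (1 - cexp t))) /\
    (forall t : C, (0 < Cmod t < r)%R ->
       cexp t - 1 <> 0 /\
       is_series (V := C_NormedModule) (egf_term t) (rhs t)) /\
    (exists g : C -> C,
       (forall t : C, (0 < Cmod t < r)%R -> g t = rhs t) /\
       (forall t : C, (Cmod t < r)%R ->
          ex_derive (K := C_AbsRing) (V := C_NormedModule) g t /\
          is_series (V := C_NormedModule) (egf_term t) (g t)) /\
       (forall n : nat, C_derive_n g n 0 = pBernoulli n p)).
Proof.
  intros egf_term rhs.
  destruct cexp_near_1 as [r [Hr Hexp]].
  destruct (is_psum_pBernoulli_fun r Hr Hexp p) as [a Ha].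
  assert (HS : forall t, (Cmod t < r)%R -> Cis_series (egf_term t) (pBernoulli_fun p t)).
  { intros t Ht. apply is_series_ext with (2 := proj2 Ha t Ht). intros n.
    unfold egf_term, pBernoulli. rewrite (is_psum_taylor r a _ n ltac:(lra) Ha).
    as_complex_eq. field. intros K. apply RtoC_inj in K. exact (INR_fact_neq_0 n K). }
  assert (HR : forall t, (0 < Cmod t < r)%R -> pBernoulli_fun p t = rhs t).
  { exact (pBernoulli_fun_closed r Hr Hexp p). }
  exists r. split; [lra|]. split; [exact HS|]. split.
  - intros t Ht. split; [apply cexp_neq_1; lra|]. rewrite <- HR by easy. apply HS, Ht.
  (* The extension is the generating function itself, so its derivatives at 0 are the p-Bernoulli
     numbers by definition. *)
  - exists (pBernoulli_fun p). split; [exact HR|]. split; [|easy].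
    intros t Ht. split; [|now apply HS].
    eexists. now apply (is_psum_derive_at r a).
Qed.
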